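(* Let $\pi$ be a uniformly random permutation of $[N]$ and $M_1,\dots,M_H\in\mathbb R^{N\times N}$ deterministic matrices satisfying Condition S1; set $\Gamma_h=\sum_{i=1}^NM_h(i,\pi(i))$ and $\Gamma=(\Gamma_1,\dots,\Gamma_H)^\top$. There is an absolute constant $C>0$ such that for every $b\in\mathbb R^H$ with $\|b\|_2=1$, $$\sup_{t\in\mathbb R}|\mathbb P\{b^\top\Gamma\le t\}-\Phi(t)|\le C\max_{i,j\in[N]}\Big|\sum_{h=1}^Hb_hM_h(i,j)\Big|.$$
   Context: Condition S1: each $M_h$ has all row sums and column sums equal to zero, $\mathrm{Tr}(M_h^\top M_h)=N-1$, and $\mathrm{Tr}(M_h^\top M_l)=0$ for $h\ne l$. $\Phi$ is the standard normal cdf.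
   Formalization: The formal statement assumes N ≥ 2; for N = 1 Condition S1 forces every M_h = 0, so Γ = 0 and the right side is 0 while the left side is at least 1/2, and the claim fails. *)

(* Defs.v *)
From HB Require Import structures.
From mathcomp Require Import all_boot all_order all_algebra all_fingroup.
From mathcomp Require Import all_classical all_reals all_analysis.
Set Implicit Arguments. Unset Strict Implicit. Unset Printing Implicit Defensive.
Import Order.TTheory GRing.Theory Num.Theory.
Local Open Scope ring_scope.

Definition Phi {R : realType} (t : R) : R :=
  fine (normal_prob (0 : R) 1 `]-oo, t]%classic).

Definition conditionS1 {R : realType} (N H : nat) (M : 'I_H -> 'M[R]_N) : Prop :=
  (forall h i, \sum_(j < N) M h i j = 0) /\
  (forall h j, \sum_(i < N) M h i j = 0) /\
  (forall h, \tr ((M h)^T *m M h) = N%:R - 1) /\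
  (forall h l, h != l -> \tr ((M h)^T *m M l) = 0).

Definition Gamma {R : realType} (N H : nat) (M : 'I_H -> 'M[R]_N)
  (s : 'S_N) (h : 'I_H) : R := \sum_(i < N) M h i (s i).

Definition bGamma {R : realType} (N H : nat) (M : 'I_H -> 'M[R]_N)
  (b : 'I_H -> R) (s : 'S_N) : R := \sum_(h < H) b h * Gamma M s h.

Definition prob_le {R : realType} (N H : nat) (M : 'I_H -> 'M[R]_N)
  (b : 'I_H -> R) (t : R) : R :=
  #|[set s : 'S_N | bGamma M b s <= t]|%:R / (N`!)%:R.

(* max_{i,j} | sum_h b_h M_h(i,j) | (0 if N = 0). *)
Definition maxentry {R : realType} (N H : nat) (M : 'I_H -> 'M[R]_N)
  (b : 'I_H -> R) : R :=
  \big[Num.max/0]_(i < N) \big[Num.max/0]_(j < N) `| \sum_(h < H) b h * M h i j |.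

(* Main.v *)
Require Import Defs.
From HB Require Import structures.
From mathcomp Require Import all_boot all_order all_algebra all_fingroup.
From mathcomp Require Import all_classical all_reals all_analysis.
From mathcomp Require Import ring lra.
Import Order.TTheory GRing.Theory Num.Theory.
Import numFieldNormedType.Exports.
Local Open Scope ring_scope.

(** Stein's method with a bounded zero-bias coupling.  Put
    [a i j = sum_h b_h M_h(i,j)], [K = max |a|] and [W s = sum_i a i (s i)], and
    let [f] solve Stein's equation [f' w - w f w = 1(w <= z) - Phi z].  Exchanging
    two values of the permutation gives
      [4 N E(W f(W)) = sum_(i,j) E(D_ij (f(W) - f(W - D_ij)))],
    where [D_ij] depends only on [p = s i] and [q = s j].  A uniform permutation
    becomes uniform on [{s | s i = p, s j = q}] after composition with two
    transpositions, which moves [W] by at most [8 K].  Hence, up to an error of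
    order [K (|W| + 1)], each difference quotient of [f] may be replaced by
    [W f(W) + 1(W <= z) - Phi z] for the original [W], provided [z] is shifted by
    [12 K] in the indicator.  The weights [D_ij ^ 2] sum to [4 N^2 (N - 1)], so the
    terms [W f(W)] cancel and [P(W <= z -+ 12 K)] is compared with [Phi z]. *)

(** * The standard normal distribution and Stein's equation *)

Lemma derive_mean_value {R : realType} (f df : R -> R) (x y : R) :
  (forall t : R, is_derive t (1 : R) f (df t)) -> x <= y ->
  exists2 c, x <= c <= y & f y - f x = df c * (y - x).
Proof.
move=> fdf xy; have [|c] := MVT_segment xy (fun t _ => fdf t).
  apply/continuous_subspaceT => t.
  by apply/differentiable_continuous/derivable1_diffP; exact: ex_derive.
by rewrite in_itv /= => ? ?; exists c.
Qed.

Section StandardNormal.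
Local Open Scope classical_set_scope.
Local Open Scope ring_scope.
Context {R : realType}.
Implicit Types x y z w : R.

Local Notation phi := (normal_pdf (0 : R) 1).

Lemma phiE x : phi x = (Num.sqrt (pi *+ 2))^-1 * expR (- (x ^+ 2 / 2)).
Proof.
rewrite normal_pdfE ?oner_neq0// /normal_peak /normal_fun.
by rewrite expr1n mul1r subr0 mulNr.
Qed.

Lemma phi_gt0 x : 0 < phi x.
Proof.
by rewrite phiE mulr_gt0 ?expR_gt0// invr_gt0 sqrtr_gt0 pmulrn_lgt0 ?pi_gt0.
Qed.

Lemma phiN x : phi (- x) = phi x.
Proof. by rewrite !phiE sqrrN. Qed.

Lemma is_derive_phi x : is_derive x 1 phi (- x * phi x).
Proof.
have -> : phi = (fun c => (Num.sqrt (pi *+ 2))^-1 * expR (- (c ^+ 2 / 2))).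
  by apply/funext => y; rewrite phiE.
apply: is_derive_eq.
rewrite /GRing.scale /=.
by set s := _^-1; set e := expR _; field.
Qed.

Lemma Phi_def x : (Phi x)%:E = normal_prob (0 : R) 1 `]-oo, x]%classic.
Proof.
by rewrite /Phi fineK// fin_num_measure.
Qed.

Lemma Phi_ge0 x : 0 <= Phi x.
Proof. by rewrite -lee_fin Phi_def measure_ge0. Qed.

Lemma Phi_le1 x : Phi x <= 1.
Proof. by rewrite -lee_fin Phi_def; apply: probability_le1. Qed.

Lemma is_derive_Phi x : is_derive x 1 (@Phi R) (phi x).
Proof.
(* The fundamental theorem of calculus is applied below [x + 1]; any right end beyond [x] would
   serve. *)
have intphi : lebesgue_measure.-integrable `]-oo, (x + 1)]%classic (EFin \o phi).
  by apply: (integrableS _ _ (@subsetT _ _)) => //; exact: integrable_normal_pdf.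
have xx1 : x < x + 1 by rewrite ltrDl.
have cphi : {for x, continuous phi}.
  by apply: continuous_normal_pdf; rewrite oner_neq0.
have [|dF <-] := @continuous_FTC1 R phi -oo%O x (x + 1) xx1 intphi _ cphi.
  by rewrite ltNye.
by rewrite derive1E; exact: derivableP dF.
Qed.

(** Under the standard normal law the identity is a random variable with cdf [Phi], so the general
    limits of a cdf at infinity apply. *)
Let idTR : measurableTypeR R -> R := idfun.

#[local] HB.instance Definition _ :=
  @isMeasurableFun.Build _ _ _ _ idTR (@measurable_id _ _ setT).

Lemma cvg_Phiy : (@Phi R) x @[x --> +oo] --> (1 : R).
Proof.
have := @cvg_cdfy1 _ _ _ (normal_prob (0 : R) 1) idTR.
by move=> /fine_cvg; apply.
Qed.

Lemma cvg_PhiNy : (@Phi R) x @[x --> -oo] --> (0 : R).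
Proof.
have := @cvg_cdfNy0 _ _ _ (normal_prob (0 : R) 1) idTR.
by move=> /fine_cvg; apply.
Qed.

Lemma Phi_lipschitz x y : x <= y -> 0 <= Phi y - Phi x <= phi 0 * (y - x).
Proof.
move=> xy; have [c _ ->] := derive_mean_value _ _ _ _ is_derive_Phi xy.
have yx0 : 0 <= y - x by rewrite subr_ge0.
rewrite mulr_ge0 ?(ltW (phi_gt0 _))//= ler_wpM2r// !phiE ler_wpM2l//.
by rewrite ler_expR expr0n/= mul0r oppr0 oppr_le0 divr_ge0 ?sqr_ge0.
Qed.

Lemma is_derive_compN (f : R -> R) (x df : R) :
  is_derive (- x) 1 f df -> is_derive x 1 (f \o -%R) (- df).
Proof.
move=> H; apply: is_derive_eq.
rewrite /GRing.scale /=; ring.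
Qed.

(** The sum [Phi y + Phi (- y)] has derivative 0 because the density is even, and it tends to 1 at
    +oo. *)
Lemma PhiN x : Phi (- x) = 1 - Phi x.
Proof.
pose g := fun y => Phi y + Phi (- y).
have dg y : is_derive y 1 g 0.
  have h1 := is_derive_Phi y.
  have h2 := is_derive_compN _ _ _ (is_derive_Phi (- y)).
  have -> : g = @Phi R \+ (@Phi R \o -%R) by [].
  by apply: is_derive_eq; rewrite phiN subrr.
have gx : g = cst (g x).
  apply/funext => y /=; apply/eqP; rewrite -subr_eq0.
  by case: (leP x y) => [|/ltW] xy;
    have [c _] := derive_mean_value _ _ _ _ dg xy; rewrite mul0r => /eqP//;
    rewrite -opprB oppr_eq0.
have : g y @[y --> +oo] --> (1 + 0 : R).
  apply: cvgD; first exact: cvg_Phiy.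
  by have := cvg_PhiNy; rewrite cvgNy_compNP.
rewrite gx => /cvg_unique/(_ (@cvg_cst _ (g x) _ _ _)).
by rewrite /g addr0 => /(_ (@Rhausdorff R)) ->; rewrite addrAC subrr add0r.
Qed.

Lemma Phi_le_exists w (e : R) : 0 < e -> exists2 x, x <= w & Phi x <= e.
Proof.
move=> e0.
have /cvgrPdist_le/(_ e e0) H := cvg_PhiNy.
have {}H : \forall x \near -oo, x <= w /\ Phi x <= e.
  near=> x; split; first by near: x; apply: nbhs_ninfty_le; rewrite num_real.
  have : `|0 - Phi x| <= e by near: x.
  by rewrite sub0r normrN ger0_norm// Phi_ge0.
by have [x [xw xe]] := filter_ex H; exists x.
Unshelve. all: by end_near. Qed.

(* For fixed [w], [phi t + w * Phi t] has derivative [(w - t) * phi t], nonnegative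
   for [t <= w]; compare its values at [w] and near -oo. *)
Lemma Mills w : w <= 0 -> - w * Phi w <= phi w.
Proof.
rewrite le_eqVlt => /predU1P[->|w0]; first by rewrite oppr0 mul0r ltW ?phi_gt0.
apply/ler_addgt0Pr => e e0.
have [|x xw Phix] := @Phi_le_exists w (e / - w).
  by rewrite divr_gt0 ?oppr_gt0.
have dk y : is_derive y 1 (fun t => phi t + w * Phi t) ((w - y) * phi y).
  have h1 := is_derive_phi y; have h2 := is_derive_Phi y.
  by apply: is_derive_eq; rewrite /GRing.scale /=; ring.
have [c /andP[_ cw] kE] := derive_mean_value _ _ _ _ dk xw.
have kc : 0 <= (w - c) * phi c * (w - x).
  by rewrite !mulr_ge0 ?subr_ge0// ltW ?phi_gt0.
have wPhi : - w * Phi x <= e.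
  by move: Phix; rewrite ler_pdivlMr ?oppr_gt0// mulrC.
have := phi_gt0 x; lra.
Qed.

(** * The bounded solution of Stein's equation *)

Definition Phi_ratio w : R := Phi w / phi w.

Lemma is_derive_Phi_ratio w :
  is_derive w 1 Phi_ratio (w * Phi_ratio w + 1).
Proof.
have h1 := is_derive_phi w; have h2 := is_derive_Phi w.
have p0 : phi w != 0 by rewrite gt_eqF ?phi_gt0.
have h3 := is_deriveV p0 h1.
rewrite /Phi_ratio; apply: is_derive_eq.
rewrite /GRing.scale /=.
by field.
Qed.

Lemma Phi_ratio_ge0 w : 0 <= Phi_ratio w.
Proof. by rewrite divr_ge0 ?Phi_ge0 ?ltW ?phi_gt0. Qed.

Lemma Phi_ratioN w : Phi_ratio (- w) = (1 - Phi w) / phi w.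
Proof. by rewrite /Phi_ratio PhiN phiN. Qed.

Lemma Phi_ratio_Mills w : w <= 0 -> - w * Phi_ratio w <= 1.
Proof.
by move=> w0; rewrite mulrA ler_pdivrMr ?phi_gt0// mul1r Mills.
Qed.

(** By [Phi_ratio_Mills] the derivative [c * Phi_ratio c + 1] is nonnegative for [c <= 0], so the
    ratio is at most its value at 0. *)
Lemma Phi_ratio_le w : w <= 0 -> Phi_ratio w <= (phi 0)^-1.
Proof.
move=> w0; have [c /andP[_ c0]] := derive_mean_value _ _ _ _ is_derive_Phi_ratio w0.
have := Phi_ratio_Mills c c0.
have h : Phi_ratio 0 <= (phi 0)^-1.
  by rewrite ler_pdivrMr ?phi_gt0// mulVf ?Phi_le1// gt_eqF ?phi_gt0.
nra.
Qed.

(* The bounded solution of Stein's equation for the indicator of [`]-oo, z]]: its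
   derivative at [w != z] is [w * stein z w + (w <= z)%:R - Phi z]. *)
Definition stein z w : R :=
  if w <= z then (1 - Phi z) * Phi_ratio w else Phi z * Phi_ratio (- w).

(** The two branches agree at [w = z], so the second formula holds there too. *)
Lemma steinr z w : z <= w -> stein z w = Phi z * Phi_ratio (- w).
Proof.
rewrite /stein le_eqVlt => /predU1P[<-|zw]; last by rewrite leNgt zw.
by rewrite lexx Phi_ratioN /Phi_ratio mulrCA !mulrA.
Qed.

Lemma stein_ge0 z w : 0 <= stein z w.
Proof.
by rewrite /stein; case: ifP => _;
  rewrite mulr_ge0 ?Phi_ratio_ge0 ?Phi_ge0 ?subr_ge0 ?Phi_le1.
Qed.

(** When the branch involves the ratio at [|w|], replacing [z] by [w] enlarges the prefactor and
    [rN] turns the ratio into the one at [- |w|]; otherwise the prefactor is at most 1. *)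
Lemma stein_le_ratio z w : stein z w <= Phi_ratio (- `|w|).
Proof.
have rN : Phi w * Phi_ratio (- w) = (1 - Phi w) * Phi_ratio w.
  by rewrite Phi_ratioN /Phi_ratio mulrCA !mulrA.
have mono x y : x <= y -> Phi x <= Phi y.
  by move=> /Phi_lipschitz/andP[]; rewrite subr_ge0.
have C0 x : 0 <= 1 - Phi x by rewrite subr_ge0 Phi_le1.
have C1 x : 1 - Phi x <= 1 by rewrite gerBl Phi_ge0.
rewrite /stein; case: ifPn => [wz|]; last rewrite -ltNge => /ltW zw;
case: (ger0P w) => w0; rewrite ?opprK.
- apply: (@le_trans _ _ ((1 - Phi w) * Phi_ratio w)).
    by rewrite ler_wpM2r ?Phi_ratio_ge0// lerB// mono.
  by rewrite -rN ler_piMl ?Phi_ratio_ge0 ?Phi_le1.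
- by rewrite ler_piMl ?Phi_ratio_ge0.
- by rewrite ler_piMl ?Phi_ratio_ge0 ?Phi_le1.
- apply: (@le_trans _ _ (Phi w * Phi_ratio (- w))).
    by rewrite ler_wpM2r ?Phi_ratio_ge0// mono.
  by rewrite rN ler_piMl ?Phi_ratio_ge0.
Qed.

Lemma stein_bound z w : `|stein z w| <= (phi 0)^-1.
Proof.
rewrite ger0_norm ?stein_ge0//; apply: le_trans (stein_le_ratio z w) _.
by rewrite Phi_ratio_le// oppr_le0.
Qed.

Lemma stein_mul_bound z w : `|w * stein z w| <= 1.
Proof.
rewrite normrM (ger0_norm (stein_ge0 _ _)).
apply: le_trans (ler_wpM2l _ (stein_le_ratio z w)) _ => //.
by have := Phi_ratio_Mills (- `|w|); rewrite opprK; apply; rewrite oppr_le0.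
Qed.

(** [stein z] has a kink at [z], so the mean value theorem is used on each side separately, where
    the indicator is constant. *)
Lemma stein_mean_value_left z x y : x <= y -> y <= z ->
  exists2 c, x <= c <= y &
  stein z y - stein z x = (c * stein z c + 1 - Phi z) * (y - x).
Proof.
move=> xy yz.
have [c /andP[xc cy] E] := derive_mean_value _ _ _ _ is_derive_Phi_ratio xy.
exists c; first by rewrite xc.
rewrite /stein yz (le_trans xy yz) (le_trans cy yz) -mulrBr E; ring.
Qed.

Lemma stein_mean_value_right z x y : x <= y -> z <= x ->
  exists2 c, x <= c <= y &
  stein z y - stein z x = (c * stein z c - Phi z) * (y - x).
Proof.
move=> xy zx; have yx : - y <= - x by rewrite lerN2.
have [c /andP[xc cy] E] := derive_mean_value _ _ _ _ is_derive_Phi_ratio yx.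
have xNc : x <= - c by rewrite lerNr.
exists (- c); first by rewrite xNc lerNl.
rewrite (steinr _ _ (le_trans zx xy)) (steinr _ _ zx) (steinr _ _ (le_trans zx xNc)).
rewrite opprK -mulrBr -(opprB (Phi_ratio _)) E; ring.
Qed.

End StandardNormal.

(** * Increments of the Stein solution *)

Section SteinIncrement.
Context {R : realType}.
Implicit Types x y z w s t c d : R.

Local Notation phi := (normal_pdf (0 : R) 1).

(** The indicator of [c <= z] is nonincreasing in [c], hence least at the right end [s]. If [z] lies
    inside the interval, the increment is split at [z]. *)
Lemma stein_increment_ge z (L : R) s t : t <= s ->
  (forall c, t <= c <= s -> L <= c * stein z c) ->
  (L + (s <= z)%R%:R - Phi z) * (s - t) <= stein z s - stein z t.
Proof.
move=> ts Lc; have ts0 : 0 <= s - t by rewrite subr_ge0.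
have [sz|zs] := leP s z.
  have [c ct ->] := stein_mean_value_left z t s ts sz.
  by rewrite ler_wpM2r// lerB// lerD// Lc.
rewrite addr0; have [tz|zt] := leP t z; last first.
  have [c ct ->] := stein_mean_value_right z t s ts (ltW zt).
  by rewrite ler_wpM2r// lerB// Lc.
have [c /andP[c1 c2] E1] := stein_mean_value_left z t z tz (lexx z).
have [e /andP[e1 e2] E2] := stein_mean_value_right z z s (ltW zs) (lexx z).
have Hc : L <= c * stein z c by rewrite Lc// c1 (le_trans c2 (ltW zs)).
have He : L <= e * stein z e by rewrite Lc// e2 (le_trans tz e1).
have := ltW zs; nra.
Qed.

Lemma stein_increment_le z (U : R) s t : t <= s ->
  (forall c, t <= c <= s -> c * stein z c <= U) ->
  stein z s - stein z t <= (U + (t <= z)%R%:R - Phi z) * (s - t).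
Proof.
move=> ts Uc; have ts0 : 0 <= s - t by rewrite subr_ge0.
have [tz|zt] := leP t z; last first.
  have [c ct ->] := stein_mean_value_right z t s ts (ltW zt).
  by rewrite addr0 ler_wpM2r// lerB// Uc.
have [sz|zs] := leP s z.
  have [c ct ->] := stein_mean_value_left z t s ts sz.
  by rewrite ler_wpM2r// lerB// lerD// Uc.
have [c /andP[c1 c2] E1] := stein_mean_value_left z t z tz (lexx z).
have [e /andP[e1 e2] E2] := stein_mean_value_right z z s (ltW zs) (lexx z).
have Hc : c * stein z c <= U by rewrite Uc// c1 (le_trans c2 (ltW zs)).
have He : e * stein z e <= U by rewrite Uc// e2 (le_trans tz e1).
have := ltW zs; rewrite mulr1n; nra.
Qed.

(** A slope is [c * stein z c], in [-1, 1], plus an indicator minus [Phi z], also in [-1, 1]. *)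
Lemma stein_lipschitz z s t : `|stein z s - stein z t| <= 2 * `|s - t|.
Proof.
wlog ts : s t / t <= s.
  move=> H; have [/H//|/ltW/H] := leP t s.
  by rewrite distrC (distrC s).
have P0 := Phi_ge0 z; have P1 := Phi_le1 z.
have ts0 : 0 <= s - t by rewrite subr_ge0.
have B c : -1 <= c * stein z c <= 1 by rewrite -ler_norml stein_mul_bound.
have L := stein_increment_ge z (-1) s t ts (fun c _ => proj1 (andP (B c))).
have U := stein_increment_le z 1 s t ts (fun c _ => proj2 (andP (B c))).
rewrite (ger0_norm ts0) ler_norml; apply/andP; split.
  apply: le_trans L; rewrite -mulNr ler_wpM2r//.
  have sz0 : 0 <= (s <= z)%R%:R :> R by [].
  lra.
apply: le_trans U _; rewrite ler_wpM2r//.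
have tz1 : (t <= z)%R%:R <= 1 :> R by rewrite lern1 leq_b1.
lra.
Qed.

Lemma mul_stein_dist z x c d : `|c - x| <= d ->
  `|c * stein z c - x * stein z x| <= (2 * `|x| + (phi 0)^-1) * d.
Proof.
move=> cx.
have -> : c * stein z c - x * stein z x
   = x * (stein z c - stein z x) + (c - x) * stein z c by ring.
apply: le_trans (ler_normD _ _) _; rewrite !normrM mulrDl; apply: lerD.
  apply: le_trans (ler_wpM2l (normr_ge0 x) (stein_lipschitz z c x)) _.
  by rewrite mulrCA mulrA ler_wpM2l// mulr_ge0.
by rewrite mulrC ler_pM ?stein_bound.
Qed.

(** The bound of [mul_stein_dist]. It stays a function of [x] because it is averaged over
    permutations later, through the first absolute moment. *)
Definition stein_err x d : R := (2 * `|x| + (phi 0)^-1) * d.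

(** The factor [s - t] makes both sides symmetric in [s] and [t], so [t <= s] may be assumed. The
    shift by [d] ensures that [x <= z - d] forces [s <= z]. *)
Lemma stein_product_ge z x d s t : `|s - x| <= d -> `|t - x| <= d ->
  (s - t) ^+ 2 * (x * stein z x - stein_err x d + (x <= z - d)%R%:R - Phi z)
  <= (s - t) * (stein z s - stein z t).
Proof.
wlog ts : s t / t <= s.
  move=> H sx tx; have [/H|/ltW/H] := leP t s; first exact.
  by move=> /(_ tx sx); nra.
move=> sx tx; have ts0 : 0 <= s - t by rewrite subr_ge0.
have bnd c : t <= c <= s -> `|c - x| <= d.
  by move: sx tx; rewrite !ler_norml; lra.
rewrite expr2 -mulrA ler_wpM2l// mulrC.
have H := stein_increment_ge z (x * stein z x - stein_err x d) s t ts _.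
apply: le_trans (H _).
  rewrite ler_wpM2r// lerB// lerD2l ler_nat.
  case: (leP x (z - d)) => // xz; suff -> : s <= z by [].
  by move: sx; rewrite ler_norml; lra.
by move=> c /bnd/mul_stein_dist - /(_ z); rewrite ler_norml /stein_err; lra.
Qed.

Lemma stein_product_le z x d s t : `|s - x| <= d -> `|t - x| <= d ->
  (s - t) * (stein z s - stein z t) <=
  (s - t) ^+ 2 * (x * stein z x + stein_err x d + (x <= z + d)%R%:R - Phi z).
Proof.
wlog ts : s t / t <= s.
  move=> H sx tx; have [/H|/ltW/H] := leP t s; first exact.
  by move=> /(_ tx sx); nra.
move=> sx tx; have ts0 : 0 <= s - t by rewrite subr_ge0.
have bnd c : t <= c <= s -> `|c - x| <= d.
  by move: sx tx; rewrite !ler_norml; lra.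
rewrite expr2 -mulrA ler_wpM2l// [leRHS]mulrC.
have H := stein_increment_le z (x * stein z x + stein_err x d) s t ts _.
apply: le_trans (H _) _.
  by move=> c /bnd/mul_stein_dist - /(_ z); rewrite ler_norml /stein_err; lra.
rewrite ler_wpM2r// lerB// lerD2l ler_nat.
case: (leP t z) => // tz; suff -> : x <= z + d by [].
by move: tx; rewrite ler_norml; lra.
Qed.

End SteinIncrement.

(** * Linear statistics of uniform permutations *)

Lemma sum_sqr_diff (R : realFieldType) (I : finType) (u : I -> R) : \sum_i u i = 0 ->
  \sum_i \sum_j (u i - u j) ^+ 2 = 2 * #|I|%:R * \sum_i u i ^+ 2.
Proof.
move=> u0.
have E i : \sum_j (u i - u j) ^+ 2 = #|I|%:R * u i ^+ 2 + \sum_j u j ^+ 2.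
  under eq_bigr => j _ do rewrite sqrrB.
  by rewrite big_split/= sumrB sumr_const sumrMnl -mulr_sumr u0 mulr0 mul0rn subr0 mulr_natl.
under eq_bigr do rewrite E.
by rewrite big_split/= -mulr_sumr sumr_const -mulr_natl; ring.
Qed.

Section PermutationStatistic.
Context {R : realFieldType} {N : nat}.
Variable a : 'I_N -> 'I_N -> R.
Implicit Types (s : 'S_N) (i j p q : 'I_N).

Definition perm_stat s : R := \sum_i a i (s i).

(** The [D_ij] of the overview; the values [p], [q] are arguments so that it is constant once [s i]
    and [s j] are fixed. *)
Definition swap_diff i j p q : R := a i p + a j q - a i q - a j p.

Lemma perm_stat_tperm i j s :
  perm_stat (tperm i j * s)%g = perm_stat s - swap_diff i j (s i) (s j).
Proof.
rewrite /perm_stat /swap_diff; have [->|ij] := eqVneq i j.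
  by rewrite tperm1 mul1g; ring.
have ji : j != i by rewrite eq_sym.
rewrite (bigD1 i)//= (bigD1 j)//= [in RHS](bigD1 i)//= [in RHS](bigD1 j)//=.
rewrite !permM tpermL tpermR.
under eq_bigr => k /andP[ki kj] do rewrite permM tpermD 1?eq_sym//.
ring.
Qed.

Lemma perm_stat_tperm_dist (K : R) i j s : (forall i j, `|a i j| <= K) ->
  `|perm_stat (tperm i j * s)%g - perm_stat s| <= 4 * K.
Proof.
move=> aK; rewrite perm_stat_tperm addrAC subrr sub0r normrN /swap_diff.
have := aK i (s i); have := aK j (s j); have := aK i (s j); have := aK j (s i).
by rewrite !ler_norml; lra.
Qed.

(** Swapping positions [i] and [k = s^-1 p] puts the value [p] at [i]. For each of the [N] possible
    [k] this is a bijection onto the permutations with [s i = p]. *)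
Lemma sum_perm_fiber1 i p (F : 'S_N -> R) :
  \sum_(s : 'S_N) F (tperm i (s^-1%g p) * s)%g = N%:R * \sum_(s : 'S_N | s i == p) F s.
Proof.
rewrite (partition_big (fun s : 'S_N => (s^-1)%g p) xpredT)//=.
have <- : \sum_(k < N) \sum_(s : 'S_N | s i == p) F s = N%:R * \sum_(s : 'S_N | s i == p) F s.
  by rewrite sumr_const card_ord mulr_natl.
apply: eq_bigr => k _.
rewrite (reindex_inj (mulgI (tperm i k))) /=.
apply: eq_big => s.
  rewrite invMg permM tpermV.
  rewrite (canF_eq (tpermK i k)) tpermR; apply/eqP/eqP => [<-|<-].
    by rewrite permKV.
  by rewrite permK.
by move/eqP => ->; rewrite mulgA tperm2 mul1g.
Qed.

(** As before, but [k = s^-1 q] differs from [i] since [p != q], leaving [N - 1] choices;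
    [tperm j k] then fixes [i] and preserves [s i = p]. *)
Lemma sum_perm_fiber2 i j p q (F : 'S_N -> R) : i != j -> p != q ->
  \sum_(s : 'S_N | s i == p) F (tperm j (s^-1%g q) * s)%g
  = (N%:R - 1) * \sum_(s : 'S_N | (s i == p) && (s j == q)) F s.
Proof.
move=> ij pq.
rewrite (partition_big (fun s : 'S_N => (s^-1)%g q) (predC1 i))/=; last first.
  by move=> s /eqP sip; apply: contraNneq pq => si; rewrite -sip -si permKV.
have -> : N%:R - 1 = #|predC1 i|%:R :> R.
  by rewrite cardC1 card_ord -subn1 natrB// (leq_ltn_trans (leq0n i)).
rewrite mulr_natl -sumr_const.
apply: eq_bigr => k /= ki.
rewrite (reindex_inj (mulgI (tperm j k))) /=.
apply: eq_big => s.
  have ti : tperm j k i = i by rewrite tpermD 1?eq_sym// eq_sym.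
  rewrite invMg !permM tpermV ti; congr (_ && _).
  rewrite (canF_eq (tpermK j k)) tpermR; apply/eqP/eqP => [<-|<-].
    by rewrite permKV.
  by rewrite permK.
by move/andP => [_ /eqP ->]; rewrite mulgA tperm2 mul1g.
Qed.

Lemma sum_perm_fiber i j p q (F : 'S_N -> R) : i != j -> p != q ->
  N%:R * (N%:R - 1) * \sum_(s : 'S_N | (s i == p) && (s j == q)) F s
  = \sum_(s : 'S_N) (let s' := (tperm i (s^-1%g p) * s)%g in F (tperm j (s'^-1%g q) * s')%g).
Proof.
move=> ij pq; rewrite -mulrA -sum_perm_fiber2//.
by rewrite -(sum_perm_fiber1 i p (fun s => F (tperm j (s^-1%g q) * s)%g)).
Qed.

Lemma sum_perm_pair i j (G : 'S_N -> R) :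
  \sum_(s : 'S_N) G s = \sum_p \sum_q \sum_(s : 'S_N | (s i == p) && (s j == q)) G s.
Proof.
rewrite (partition_big (fun s : 'S_N => s i) xpredT)//=; apply: eq_bigr => p _.
by rewrite (partition_big (fun s : 'S_N => s j) xpredT).
Qed.

(** * Exchange of two values and the coupling inequality *)

Hypothesis row0 : forall i, \sum_j a i j = 0.
Hypothesis col0 : forall j, \sum_i a i j = 0.

Lemma sum_swap_diff s :
  \sum_i \sum_j swap_diff i j (s i) (s j) = 2 * N%:R * perm_stat s.
Proof.
have rs i : \sum_j a i (s j) = 0.
  by apply: etrans (row0 i); rewrite [RHS](reindex_inj (@perm_inj _ s)).
rewrite /swap_diff.
have E i : \sum_j (a i (s i) + a j (s j) - a i (s j) - a j (s i))
  = N%:R * a i (s i) + perm_stat s.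
  by rewrite !sumrB big_split/= rs col0 !subr0 sumr_const card_ord mulr_natl.
under eq_bigr do rewrite E.
by rewrite big_split/= -mulr_sumr sumr_const card_ord -mulr_natl /perm_stat; ring.
Qed.

(** Reindexing by [tperm i j] flips the sign of [swap_diff] and exchanges the two arguments of [f],
    so both halves of the difference contribute equally; [sum_swap_diff] then sums over [i] and
    [j]. *)
Lemma exchange_pair (f : R -> R) :
  4 * N%:R * \sum_(s : 'S_N) perm_stat s * f (perm_stat s) =
  \sum_i \sum_j \sum_(s : 'S_N) swap_diff i j (s i) (s j) *
    (f (perm_stat s) - f (perm_stat s - swap_diff i j (s i) (s j))).
Proof.
have E i j : \sum_(s : 'S_N) swap_diff i j (s i) (s j) *
    (f (perm_stat s) - f (perm_stat s - swap_diff i j (s i) (s j)))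
  = 2 * \sum_(s : 'S_N) swap_diff i j (s i) (s j) * f (perm_stat s).
  under eq_bigr do rewrite mulrBr.
  rewrite sumrB mulr_natl mulr2n; congr (_ + _).
  rewrite -sumrN [RHS](reindex_inj (mulgI (tperm i j))) /=.
  apply: eq_bigr => s _; rewrite perm_stat_tperm !permM tpermL tpermR.
  by rewrite -mulNr; congr (_ * _); rewrite /swap_diff; ring.
apply: esym.
under eq_bigr => i _ do under eq_bigr => j _ do rewrite E.
under eq_bigr => i _ do rewrite -mulr_sumr exchange_big /=.
rewrite -mulr_sumr exchange_big /= !mulr_sumr; apply: eq_bigr => s _.
under eq_bigr => i _ do rewrite -mulr_suml.
by rewrite -mulr_suml sum_swap_diff; ring.
Qed.

(** [swap_diff i j p q] is [u p - u q] for [u = a i - a j], which sums to 0. Thus [sum_sqr_diff]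
    applies twice, in [p, q] by the row sums and in [i, j] by the column sums. *)
Lemma sum_swap_diff_sqr :
  \sum_i \sum_j \sum_p \sum_q swap_diff i j p q ^+ 2
  = 4 * N%:R ^+ 2 * \sum_i \sum_j a i j ^+ 2.
Proof.
have E i j : \sum_p \sum_q swap_diff i j p q ^+ 2
   = 2 * N%:R * \sum_p (a i p - a j p) ^+ 2.
  have := @sum_sqr_diff _ _ (fun p => a i p - a j p).
  rewrite sumrB !row0 subrr card_ord => <-//.
  by do 2!(apply: eq_bigr => ? _); congr (_ ^+ 2); rewrite /swap_diff; ring.
under eq_bigr => i _ do under eq_bigr => j _ do rewrite E.
under eq_bigr do rewrite -mulr_sumr.
rewrite -mulr_sumr.
under eq_bigr do rewrite exchange_big/=.
rewrite exchange_big /=.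
under eq_bigr do rewrite sum_sqr_diff//.
rewrite -mulr_sumr card_ord exchange_big /=; ring.
Qed.

Hypothesis sqr_sum : \sum_i \sum_j a i j ^+ 2 = N%:R - 1.
Hypothesis N_ge2 : (2 <= N)%N.
Variable K : R.
Hypothesis aK : forall i j, `|a i j| <= K.

Lemma swap_diff_diag i p q : swap_diff i i p q = 0.
Proof. by rewrite /swap_diff; ring. Qed.

Lemma swap_diff_same i j p : swap_diff i j p p = 0.
Proof. by rewrite /swap_diff; ring. Qed.

(* [f] stands for a Stein solution and [g x] for a lower bound of its slopes near [x]. *)
Lemma stein_coupling_ge (f g : R -> R) :
  (forall x y z : R, `|y - x| <= 12 * K -> `|z - x| <= 12 * K ->
     (y - z) ^+ 2 * g x <= (y - z) * (f y - f z)) ->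
  \sum_(s : 'S_N) g (perm_stat s) <= \sum_(s : 'S_N) perm_stat s * f (perm_stat s).
Proof.
move=> fg; set G := (X in X <= _).
have N1 : 0 < N%:R - 1 :> R by rewrite subr_gt0 ltr1n.
have N0 : 0 < N%:R :> R by rewrite ltr0n; apply: leq_trans N_ge2.
have K0 : 0 <= K.
  have i0 : 'I_N by apply: Ordinal N_ge2.
  exact: le_trans (aK i0 i0).
have pair i j : \sum_p \sum_q swap_diff i j p q ^+ 2 * G
    <= N%:R * (N%:R - 1) * \sum_(s : 'S_N) swap_diff i j (s i) (s j) *
    (f (perm_stat s) - f (perm_stat s - swap_diff i j (s i) (s j))).
  have [->|ij] := eqVneq i j.
    rewrite [X in X <= _]big1 => [|p _]; last first.
      by rewrite big1// => q _; rewrite swap_diff_diag expr0n mul0r.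
    by rewrite big1 ?mulr0// => s _; rewrite swap_diff_diag mul0r.
  rewrite (sum_perm_pair i j) mulr_sumr; apply: ler_sum => p _.
  rewrite mulr_sumr; apply: ler_sum => q _.
  (* No permutation sends distinct [i], [j] to one value; the summands vanish here in any case. *)
  have [->|pq] := eqVneq p q.
    rewrite swap_diff_same expr0n mul0r big1 ?mulr0// => s /andP[/eqP -> /eqP ->].
    by rewrite swap_diff_same mul0r.
  under eq_bigr => s /andP[/eqP -> /eqP ->] do [].
  rewrite (sum_perm_fiber _ _ _ _ _ ij pq) mulr_sumr; apply: ler_sum => s _ /=.
  set s1 := (tperm i _ * s)%g; set s2 := (tperm j _ * s1)%g.
  have s1i : s1 i = p by rewrite permM tpermL permKV.
  have s2j : s2 j = q by rewrite permM tpermL permKV.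
  have s2i : s2 i = p.
    rewrite permM tpermD// 1?eq_sym//.
    by apply: contraNneq pq => qi; rewrite -s1i qi permKV.
  (* Each transposition moves the statistic by at most [4 * K]: two lead from [s] to [s2], a third
     exchanges [i] and [j], whence the radius [12 * K]. *)
  have d1 := perm_stat_tperm_dist K i (s^-1%g p) s aK.
  have d2 := perm_stat_tperm_dist K j (s1^-1%g q) s1 aK.
  have d3 := perm_stat_tperm_dist K i j s2 aK.
  rewrite perm_stat_tperm s2i s2j in d3.
  have := fg (perm_stat s) (perm_stat s2) (perm_stat s2 - swap_diff i j p q).
  rewrite subKr; apply.
    by move: d1 d2; rewrite -/s1 -/s2 !ler_norml; lra.
  by move: d1 d2 d3; rewrite -/s1 -/s2 !ler_norml; lra.
have : \sum_i \sum_j \sum_p \sum_q swap_diff i j p q ^+ 2 * G <=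
  N%:R * (N%:R - 1) * (4 * N%:R * \sum_(s : 'S_N) perm_stat s * f (perm_stat s)).
  rewrite exchange_pair mulr_sumr; apply: ler_sum => i _.
  by rewrite mulr_sumr; apply: ler_sum => j _.
under eq_bigr do under eq_bigr do under eq_bigr do rewrite -mulr_suml.
under eq_bigr do under eq_bigr do rewrite -mulr_suml.
under eq_bigr do rewrite -mulr_suml.
rewrite -mulr_suml sum_swap_diff_sqr sqr_sum.
(* Both sides share the factor [4 * N ^ 2 * (N - 1)], positive because [N >= 2]. *)
have -> : forall x : R, N%:R * (N%:R - 1) * (4 * N%:R * x) = 4 * N%:R ^+ 2 * (N%:R - 1) * x.
  by move=> x; ring.
rewrite ler_pM2l// mulr_gt0// mulr_gt0// exprn_gt0//.
Qed.

(** The coupling inequality with [f = - id], whose slope is -1 everywhere; the minus sign yields an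
    upper bound on the second moment. *)
Lemma sum_perm_stat_sqr_le :
  \sum_(s : 'S_N) perm_stat s ^+ 2 <= N`!%:R.
Proof.
have : \sum_(s : 'S_N) -1 <= \sum_(s : 'S_N) perm_stat s * - perm_stat s.
  by apply: (stein_coupling_ge -%R (fun=> -1)) => x y z _ _; nra.
under [X in _ <= X]eq_bigr do rewrite mulrN.
by rewrite !sumrN sumr_const card_Sn lerN2.
Qed.

Lemma sum_norm_perm_stat_le : \sum_(s : 'S_N) `|perm_stat s| <= N`!%:R.
Proof.
have h : \sum_(s : 'S_N) `|perm_stat s| <= \sum_(s : 'S_N) (1 + perm_stat s ^+ 2) / 2.
  apply: ler_sum => s _; rewrite -[perm_stat s ^+ 2]real_normK ?num_real//.
  have := sqr_ge0 (`|perm_stat s| - 1); lra.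
apply: le_trans h _; rewrite -mulr_suml big_split /= sumr_const card_Sn.
have := sum_perm_stat_sqr_le; lra.
Qed.

End PermutationStatistic.

(** * Berry-Esseen bound for a single matrix *)

Section BerryEsseen.
Context {R : realType} {N : nat}.
Variables (a : 'I_N -> 'I_N -> R) (K : R).
Hypothesis row0 : forall i, \sum_j a i j = 0.
Hypothesis col0 : forall j, \sum_i a i j = 0.
Hypothesis sqr_sum : \sum_i \sum_j a i j ^+ 2 = N%:R - 1.
Hypothesis N_ge2 : (2 <= N)%N.
Hypothesis aK : forall i j, `|a i j| <= K.

Local Notation phi := (normal_pdf (0 : R) 1).
Local Notation W := (perm_stat a).
Local Notation cdfW t := ((\sum_(s : 'S_N) (W s <= t)%R%:R) / N`!%:R : R).

Let factN_gt0 : 0 < N`!%:R :> R.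
Proof. by rewrite ltr0n fact_gt0. Qed.

Let K_ge0 : 0 <= K.
Proof.
have i0 : 'I_N by apply: Ordinal N_ge2.
exact: le_trans (aK i0 i0).
Qed.

Lemma sum_stein_err_le (d : R) : 0 <= d ->
  \sum_(s : 'S_N) stein_err (W s) d <= N`!%:R * ((2 + (phi 0)^-1) * d).
Proof.
move=> d0; rewrite -mulr_suml big_split /= -mulr_sumr sumr_const card_Sn.
rewrite mulrA ler_wpM2r// -(mulr_natr _^-1).
have := sum_norm_perm_stat_le a row0 col0 sqr_sum N_ge2 K aK; lra.
Qed.

(** Use [f = stein z] with [z = t + 12 * K], so that the shifted indicator becomes that of [W <= t].
    The terms [W * f W] cancel. *)
Lemma cdf_perm_stat_le (t : R) :
  cdfW t <= Phi (t + 12 * K) + (2 + (phi 0)^-1) * (12 * K).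
Proof.
set z := t + 12 * K.
have := stein_coupling_ge a row0 col0 sqr_sum N_ge2 K aK _ _
  (fun x y w => @stein_product_ge _ z x _ y w).
rewrite ler_pdivrMr// sumrB big_split sumrB /= sumr_const card_Sn -/z addrK.
have := sum_stein_err_le (12 * K) _; rewrite mulr_ge0// => /(_ isT).
rewrite -(mulr_natr (Phi z)); nra.
Qed.

(** The coupling inequality bounds from one side only, so it is applied to [- stein z], with
    [z = t - 12 * K]. *)
Lemma cdf_perm_stat_ge (t : R) :
  Phi (t - 12 * K) - (2 + (phi 0)^-1) * (12 * K) <= cdfW t.
Proof.
set z := t - 12 * K.
have : \sum_(s : 'S_N) - (W s * stein z (W s) + stein_err (W s) (12 * K)
      + (W s <= z + 12 * K)%R%:R - Phi z) <= \sum_(s : 'S_N) W s * - stein z (W s).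
  apply: (stein_coupling_ge a row0 col0 sqr_sum N_ge2 K aK (fun x => - stein z x)
    (fun x => - (x * stein z x + stein_err x (12 * K) + (x <= z + 12 * K)%R%:R - Phi z))).
  move=> x y w yx wx; rewrite mulrN -opprD mulrN lerN2.
  exact: stein_product_le.
have -> : z + 12 * K = t by rewrite /z subrK.
rewrite ler_pdivlMr//.
under [X in _ <= X]eq_bigr do rewrite mulrN.
rewrite !sumrN lerN2 sumrB 2!big_split /= sumr_const card_Sn.
have := sum_stein_err_le (12 * K) _; rewrite mulr_ge0// => /(_ isT).
rewrite -(mulr_natr (Phi z)); nra.
Qed.

(** In the constant, [phi 0] pays for shifting the argument of [Phi] by [12 * K], and
    [2 + (phi 0)^-1] is the averaged Stein error. *)
Lemma combinatorial_berry_esseen (t : R) :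
  `|cdfW t - Phi t| <= 12 * (phi 0 + 2 + (phi 0)^-1) * K.
Proof.
have K12 : 0 <= 12 * K by rewrite mulr_ge0.
have tK : t <= t + 12 * K by rewrite lerDl.
have Kt : t - 12 * K <= t by rewrite gerBl.
have /andP[_] := Phi_lipschitz _ _ tK; have /andP[_] := Phi_lipschitz _ _ Kt.
have := cdf_perm_stat_le t; have := cdf_perm_stat_ge t.
rewrite ler_norml; lra.
Qed.

End BerryEsseen.

(** * Reduction of several matrices to one linear combination *)

Theorem theoremS1 (R : realType) :
  exists C : R, 0 < C /\
    forall (N H : nat) (M : 'I_H -> 'M[R]_N),
      (2 <= N)%N -> conditionS1 M ->
      forall b : 'I_H -> R, \sum_(h < H) b h ^+ 2 = 1 ->
      forall t : R, `| prob_le M b t - Phi t | <= C * maxentry M b.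
Proof.
exists (12 * (normal_pdf (0 : R) 1 0 + 2 + (normal_pdf (0 : R) 1 0)^-1)); split.
  by have := phi_gt0 (0 : R) => p0; rewrite mulr_gt0// !addr_gt0// invr_gt0.
move=> N H M N2 [row0 [col0 [trM trMM]]] b b1 t.
pose a i j := \sum_h b h * M h i j.
have bGammaE s : bGamma M b s = perm_stat a s.
  rewrite /bGamma /Gamma /perm_stat exchange_big /=.
  by apply: eq_bigr => i _; rewrite mulr_sumr.
have -> : prob_le M b t = (\sum_(s : 'S_N) (perm_stat a s <= t)%R%:R) / N`!%:R.
  rewrite /prob_le -sum1_card natr_sum big_mkcond /=; congr (_ / _).
  by apply: eq_bigr => s _; rewrite inE bGammaE; case: ifP.
apply: combinatorial_berry_esseen => //.
- move=> i; rewrite exchange_big big1//= => h _.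
  by rewrite -mulr_sumr row0 mulr0.
- move=> j; rewrite exchange_big big1//= => h _.
  by rewrite -mulr_sumr col0 mulr0.
- have trE h l : \tr ((M h)^T *m M l) = \sum_i \sum_j M h i j * M l i j.
    rewrite /mxtrace exchange_big /=; apply: eq_bigr => j _.
    by rewrite mxE; apply: eq_bigr => i _; rewrite mxE.
  (* The squared Frobenius norm of the combination expands into traces; orthogonality leaves the
     terms [h = l], and [b] is a unit vector. *)
  have -> : \sum_i \sum_j a i j ^+ 2
      = \sum_h \sum_l b h * b l * \tr ((M h)^T *m M l).
    under [RHS]eq_bigr do under eq_bigr do rewrite trE mulr_sumr.
    under [RHS]eq_bigr do rewrite exchange_big /=.
    rewrite [RHS]exchange_big /=; apply: eq_bigr => i _.
    under [RHS]eq_bigr do under eq_bigr do rewrite mulr_sumr.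
    under [RHS]eq_bigr do rewrite exchange_big /=.
    rewrite [RHS]exchange_big /=; apply: eq_bigr => j _.
    rewrite expr2 /a mulr_suml; apply: eq_bigr => h _.
    by rewrite mulr_sumr; apply: eq_bigr => l _; ring.
  transitivity (\sum_h b h ^+ 2 * (N%:R - 1)); last by rewrite -mulr_suml b1 mul1r.
  apply: eq_bigr => h _.
  rewrite (bigD1 h)//= big1 ?addr0 ?trM ?expr2// => l lh.
  by rewrite trMM ?mulr0// eq_sym.
- move=> i j; rewrite /maxentry.
  apply: le_trans (le_bigmax _ _ i).
  exact: (le_bigmax _ (fun j => `|a i j|) j).
Qed.
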